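(* For every bipartite network game with random memory (and every initial matching), random dynamics converge to a locally stable matching with probability $1$.
   Context: A network game consists of a set $V$ of players, a network $N=(V,L)$ of links, and a set $E$ of potential matching edges; a state is a matching $M\subseteq E$. Each player has a strict preference order over its possible partners (those $w$ with $\{v,w\}\in E$) and prefers being matched to being unmatched. The game is bipartite if $V=U\cup W$ and every edge of $E$ joins $U$ and $W$ (links are unrestricted). In state $M$, two players are accessible if their distance in $(V,L\cup M)$ is at most $2$, or if one of them is in the memory of the other. A local blocking pair is a pair $\{u,v\}\in E$ of accessible players each of which is unmatched or strictly prefers the other to its current partner; a locally stable matching has no local blocking pair. A local improvement step picks a local blocking pair $\{u,v\}$, adds it to $M$ and removes all edges of $M$ incident to $u$ or $v$. Random dynamics: in each step the local blocking pair to resolve is chosen uniformly at random among those available. With random memory, in every round each player remembers one of its previous matching partners chosen uniformly at random. *)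

(* Defs.v *)
From HB Require Import structures.
From mathcomp Require Import all_boot all_order all_algebra.
From mathcomp Require Import all_classical all_reals all_analysis.

Set Implicit Arguments.
Unset Strict Implicit.
Unset Printing Implicit Defensive.

Import Order.TTheory GRing.Theory Num.Theory.
Local Open Scope ring_scope.

(* Links and potential matching edges are two-element sets of players.
   [pref v w w'] reads: v strictly prefers w to w'. It is only constrained on
   the possible partners of v; being matched rather than unmatched is always
   preferred (see [welcomes]). *)
Record network_game := NetworkGame {
  player : finType;
  links : {set {set player}};
  edges : {set {set player}};
  pref : player -> rel player;
  links_card2 : forall e, e \in links -> #|e| = 2%N;
  edges_card2 : forall e, e \in edges -> #|e| = 2%N;
  pref_irr : forall v w, [set v; w] \in edges -> ~~ pref v w w;
  pref_trans : forall v w1 w2 w3,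
    [set v; w1] \in edges -> [set v; w2] \in edges -> [set v; w3] \in edges ->
    pref v w1 w2 -> pref v w2 w3 -> pref v w1 w3;
  pref_total : forall v w1 w2,
    [set v; w1] \in edges -> [set v; w2] \in edges -> w1 != w2 ->
    pref v w1 w2 || pref v w2 w1
}.

Definition bipartite (G : network_game) : Prop :=
  exists U W : {set player G},
    [/\ U :|: W = [set: player G], [disjoint U & W] &
        forall e, e \in edges G ->
          exists u w, [/\ u \in U, w \in W & e = [set u; w]]].

Section Dynamics.
Variable G : network_game.
Notation V := (player G).

Definition matching (M : {set {set V}}) : bool :=
  (M \subset edges G) && finset.trivIset M.

Definition partners (M : {set {set V}}) (v : V) : {set V} :=
  [set w | [set v; w] \in M].

(* Each player remembers at most one player in a given round: exactly one as
   soon as it has a previous partner, see [memory_prob]. *)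
Definition memory := {ffun V -> option V}.

Definition adjacent (M : {set {set V}}) : rel V :=
  fun u v => [set u; v] \in links G :|: M.

(* A walk of length at most 2 from u to v in (V, L + M), or memory. *)
Definition accessible (M : {set {set V}}) (m : memory) (u v : V) : bool :=
  [|| [exists p : 2.-bseq V, path (adjacent M) u p && (last u p == v)],
      m u == Some v | m v == Some u].

Definition welcomes (M : {set {set V}}) (u v : V) : bool :=
  (partners M u == finset.set0) || [forall w in partners M u, pref u v w].

Definition local_blocking_pairs (M : {set {set V}}) (m : memory) :
    {set {set V}} :=
  [set e in edges G | [exists u, exists v,
    [&& e == [set u; v], accessible M m u v, welcomes M u v
      & welcomes M v u]]].

Definition locally_stable_matching (M : {set {set V}}) (m : memory) : bool :=
  matching M && (local_blocking_pairs M m == finset.set0).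

Definition resolve (M : {set {set V}}) (e : {set V}) : {set {set V}} :=
  e |: [set f in M | [disjoint f & e]].

(* For each player, the set of its partners in the earlier rounds. *)
Definition history := {ffun V -> {set V}}.

Definition record_partners (M : {set {set V}}) (H : history) : history :=
  [ffun v => H v :|: partners M v].

(* In round t the state consists of the current matching, the partners of each
   player in rounds 0, ..., t - 1, and the memory drawn for round t. *)
Definition state : Type := ({set {set V}} * history * memory)%type.
Definition matching_of (x : state) : {set {set V}} := x.1.1.
Definition history_of (x : state) : history := x.1.2.
Definition memory_of (x : state) : memory := x.2.

Variable R : realType.

(* The players draw independently, each one uniformly from the set of its
   distinct previous partners (nothing is remembered if that set is empty). *)
Definition memory_prob (H : history) (m : memory) : R :=
  \prod_(v : V)
    match m v with
    | Some w => if w \in H v then #|H v|%:R^-1 else 0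
    | None => (H v == finset.set0)%:R
    end.

Definition step_prob (M : {set {set V}}) (m : memory)
    (M' : {set {set V}}) : R :=
  let B := local_blocking_pairs M m in
  if B == finset.set0 then (M' == M)%:R
  else \sum_(e in B) #|B|%:R^-1 * (M' == resolve M e)%:R.

Definition initial_prob (M0 : {set {set V}}) (x : state) : R :=
  (matching_of x == M0)%:R * (history_of x == [ffun => finset.set0])%:R
  * memory_prob (history_of x) (memory_of x).

Definition transition_prob (x y : state) : R :=
  step_prob (matching_of x) (memory_of x) (matching_of y)
  * (history_of y == record_partners (matching_of x) (history_of x))%:R
  * memory_prob (history_of y) (memory_of y).

(* X is the Markov chain of the random dynamics with random memory started in
   M0, described by its finite-dimensional distributions. *)
Definition random_dynamics (M0 : {set {set V}}) (d : measure_display)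
    (Omega : measurableType d) (P : probability Omega R)
    (X : nat -> Omega -> state) : Prop :=
  (forall t x, measurable [set w | X t w = x]%classic) /\
  (forall t (x : nat -> state),
    P [set w | forall s, (s <= t)%N -> X s w = x s]%classic
    = (initial_prob M0 (x 0%N)
       * \prod_(0 <= s < t) transition_prob (x s) (x s.+1))%:E).

End Dynamics.

(* With random memory, stability is relative to the memory drawn in the current
   round, so the limit must be free of local blocking pairs in all rounds from
   some time on. *)
Definition converges_to_locally_stable (G : network_game)
    (x : nat -> state G) : Prop :=
  exists (M : {set {set player G}}) (T : nat), forall t, (T <= t)%N ->
    matching_of (x t) = M /\ locally_stable_matching M (memory_of (x t)).

(* Main.v *)
(* A state from which the recorded histories can no longer grow only ever has
   blocking pairs that are already remembered with positive probability. Hence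
   from there the dynamics can realise every better-response sequence of the
   stable marriage problem restricted to the remembered pairs, and one of these
   sequences ends in a matching that is stable for them (Roth and Vande Vate);
   such a matching is locally stable for ever. So an absorbing state can be
   reached from every reachable state of a finite Markov chain, which is
   therefore absorbed almost surely. *)
Require Import Defs.
From HB Require Import structures.
From mathcomp Require Import all_boot all_order all_algebra.

Set Implicit Arguments.
Unset Strict Implicit.
Unset Printing Implicit Defensive.

Import Order.TTheory GRing.Theory Num.Theory.

(** * Paths to stable matchings *)

(** Induction on a bound for [f]. Each phase of [connect_stable] is one instance, with its own
    potential. *)
Lemma connect_descent (T : finType) (e : rel T) (f : T -> nat)
    (P Q : T -> Prop) :
    (forall x, P x -> Q x \/ exists y, [/\ e x y, P y & f y < f x]) ->
  forall x, P x -> exists y, [/\ connect e x y, P y & Q y].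
Proof.
move=> desc x; have [n] := ubnP (f x); elim: n x => // n IHn x.
rewrite ltnS => le_fx_n Px; have [Qx|[y [exy Py lt_fy]]] := desc x Px.
  by exists x.
have [z [yz Pz Qz]] := IHn y (leq_trans lt_fy le_fx_n) Py.
by exists z; split=> //; apply: connect_trans yz; apply: connect1.
Qed.

Lemma connect_invariant (T : finType) (e : rel T) (P : T -> Prop) x y :
  (forall z t, P z -> e z t -> P t) -> P x -> connect e x y -> P y.
Proof.
move=> inv Px /connectP[p pth ->] {y}.
elim: p x Px pth => //= z p IHp x Px /andP[xz]; apply: IHp.
exact: inv Px xz.
Qed.

Section Matchings.
Variable G : network_game.
Notation V := (player G).
Implicit Types (M F : {set {set V}}) (a b u v w : V).

Lemma welcomesP M u v :
  reflect (forall w, [set u; w] \in M -> pref u v w) (welcomes M u v).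
Proof.
apply: (iffP orP) => [[/eqP M0 w uw|/forallP pr w uw]|pr].
- have : w \in partners M u by rewrite inE.
  by rewrite M0 inE.
- by have /implyP := pr w; apply; rewrite inE.
- by right; apply/forallP => w; rewrite inE; apply/implyP/pr.
Qed.

Lemma edge_neq u v : [set u; v] \in edges G -> u != v.
Proof. by move/edges_card2; rewrite cards2; case: (u != v). Qed.

Lemma matching_edges M e : matching M -> e \in M -> e \in edges G.
Proof. by move=> /andP[/subsetP + _]; apply. Qed.

Lemma matching_inj M u v w :
  matching M -> [set u; v] \in M -> [set u; w] \in M -> v = w.
Proof.
move=> mM uv uw; have /edge_neq neq_uv := matching_edges mM uv.
have /edge_neq neq_uw := matching_edges mM uw.
move/andP: mM => [_ /trivIsetP/(_ _ _ uv uw)].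
case: eqVneq => [eq_e _|_ /(_ isT)].
  have : v \in [set u; w] by rewrite -eq_e !inE eqxx orbT.
  by rewrite !inE eq_sym (negPf neq_uv) => /eqP.
by move=> /pred0P/(_ u) /=; rewrite !inE eqxx.
Qed.

Lemma resolve_matching M e :
  matching M -> e \in edges G -> matching (resolve M e).
Proof.
move=> /andP[/subsetP sM /trivIsetP tM] eE; apply/andP; split.
  by apply/subsetP => f /setU1P[->//|]; rewrite inE => /andP[/sM].
apply/trivIsetP => f g fR gR; move: gR fR.
case/setU1P => [->|]; [|rewrite inE => /andP[gM dge]];
  case/setU1P => [->|]; rewrite ?eqxx // ?inE; first by case/andP.
  by rewrite disjoint_sym.
by case/andP => fM _; apply: tM.
Qed.

Definition crossing (U W : {set V}) : Prop := [disjoint U & W] /\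
  forall e, e \in edges G -> exists u w, [/\ u \in U, w \in W & e = [set u; w]].

(** Membership in [F] stands in for accessibility; [F] will be the set of remembered pairs. *)
Definition blocks F M u w : bool :=
  [&& [set u; w] \in F, welcomes M u w & welcomes M w u].

Definition improves F : rel {set {set V}} := fun M M' =>
  [exists u, exists w, blocks F M u w && (M' == resolve M [set u; w])].

Lemma blocks_sym F M u w : blocks F M u w = blocks F M w u.
Proof. by rewrite /blocks (setUC [set u]) [in X in _ && X]andbC. Qed.

Lemma improves_resolve F M u w :
  blocks F M u w -> improves F M (resolve M [set u; w]).
Proof.
by move=> bl; apply/existsP; exists u; apply/existsP; exists w; rewrite bl /=.
Qed.

(** * Better responses in a bipartite instance *)

Section Bipartite.
Variables U W : {set V}.
Hypothesis crossUW : crossing U W.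

Lemma crossing_neq u w : u \in U -> w \in W -> u != w.
Proof.
case: crossUW => dUW _ uU wW; apply: contraTneq wW => <-.
by rewrite (disjointFr dUW uU).
Qed.

Lemma crossing_edge u w : [set u; w] \in edges G -> (u \in U) = (w \in W).
Proof.
case: crossUW => dUW ex uw; have [u' [w' [u'U w'W eq_e]]] := ex _ uw.
have neq_uw := edge_neq uw.
have : u \in [set u'; w'] by rewrite -eq_e !inE eqxx.
have : w \in [set u'; w'] by rewrite -eq_e !inE eqxx orbT.
rewrite !inE => /orP[]/eqP ew /orP[]/eqP eu; subst u w.
- by rewrite eqxx in neq_uw.
- by rewrite (disjointFr dUW u'U) (disjointFl dUW w'W).
- by rewrite u'U w'W.
- by rewrite eqxx in neq_uw.
Qed.

(** With the sides fixed, equality of unordered pairs becomes equality of coordinates, and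
    disjointness becomes [a != u] and [b != w]. *)
Lemma mem_resolve M u w a b : u \in U -> w \in W -> a \in U -> b \in W ->
  ([set a; b] \in resolve M [set u; w]) =
  (a == u) && (b == w) || [&& [set a; b] \in M, a != u & b != w].
Proof.
move=> uU wW aU bW; rewrite !inE; congr (_ || _ && _).
  apply/eqP/andP => [eq_e|[/eqP-> /eqP->]//].
  have : a \in [set u; w] by rewrite -eq_e !inE eqxx.
  have : b \in [set u; w] by rewrite -eq_e !inE eqxx orbT.
  rewrite !inE (negPf (crossing_neq aU wW)) orbF.
  by rewrite eq_sym (negPf (crossing_neq uU bW)).
rewrite disjoints_subset subUset !sub1set !inE.
rewrite !negb_or (crossing_neq aU wW) andbT.
by rewrite [in X in _ && X]eq_sym (crossing_neq uU bW).
Qed.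

Lemma blocks_partner_neq F M u w x :
  F \subset edges G -> blocks F M u w -> [set u; x] \in M -> x != w.
Proof.
move=> /subsetP sF /and3P[/sF uwE /welcomesP uw _] /uw.
by apply: contraTneq => ->; apply: pref_irr.
Qed.

(* Potential of the first phase of [connect_stable]: its section at v shrinks
   when v improves or loses its partner. *)
Definition upper M : {set V * V} :=
  [set p | [&& p.1 \in U, [set p.1; p.2] \in edges G &
    [exists x, ([set p.1; x] \in M) && ((p.2 == x) || pref p.1 p.2 x)]]].

(* Potential of the second phase of [connect_stable]: its section at w grows
   when w improves. *)
Definition lower M : {set V * V} :=
  [set p | [&& p.1 \in W, [set p.1; p.2] \in edges G &
    [exists x, ([set p.1; x] \in M) && ((p.2 == x) || pref p.1 x p.2)]]].

Definition is_matched M v : bool := [exists x, [set v; x] \in M].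

(** The section at [u] loses at least [(u, x)], as [u] leaves [x] for the preferred [w]. The
    previous partner of [w], if any, loses its whole section, and no other section changes. *)
Lemma upper_decr F M u w : F \subset edges G -> matching M -> u \in U ->
  is_matched M u -> blocks F M u w ->
  upper (resolve M [set u; w]) \proper upper M.
Proof.
move=> sF mM uU /existsP[x ux] bl; have neq_xw := blocks_partner_neq sF bl ux.
case/and3P: bl => /(subsetP sF) uwE /welcomesP uw /welcomesP wu.
have wW : w \in W by rewrite -(crossing_edge uwE).
have uxE := matching_edges mM ux; have pwx := uw _ ux.
apply/properP; split.
  apply/subsetP => -[a b]; rewrite !inE /= => /and3P[aU abE /existsP[y]].
  rewrite aU abE /=.
  case: (boolP ([set a; y] \in edges G)) => [ayE|nayE]; last first.
    have mR := resolve_matching mM uwE.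
    by case/andP => /(matching_edges mR) /[!(negPf nayE)].
  have yW : y \in W by rewrite -(crossing_edge ayE).
  rewrite (mem_resolve _ uU wW aU yW) => /andP[/orP[/andP[/eqP ea /eqP ey]|]].
    subst a y => by_; apply/existsP; exists x; rewrite ux /=.
    case/orP: by_ => [/eqP->|pbw]; first by rewrite pwx orbT.
    by rewrite (pref_trans abE uwE uxE pbw pwx) orbT.
  by case/and3P => ayM _ _ by_; apply/existsP; exists y; rewrite ayM.
exists (u, x); rewrite !inE /= uU uxE /=.
  by apply/existsP; exists x; rewrite ux eqxx.
apply/existsP => -[y /andP[]].
case: (boolP ([set u; y] \in edges G)) => [uyE|nuyE]; last first.
  have mR := resolve_matching mM uwE.
  by move/(matching_edges mR); rewrite (negPf nuyE).
have yW : y \in W by rewrite -(crossing_edge uyE).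
rewrite (mem_resolve _ uU wW uU yW) eqxx /= andbF orbF => /eqP->.
rewrite (negPf neq_xw) /= => pxw.
by have := pref_trans uxE uwE uxE pxw pwx; rewrite (negPf (pref_irr uxE)).
Qed.

(** As [u] is unmatched, no player of [W] is abandoned. Only the section at [w] changes: it gains
    [(w, u)], which was missing because [w] prefers [u] to any current partner. *)
Lemma lower_incr F M u w : F \subset edges G -> matching M -> u \in U ->
  ~~ is_matched M u -> blocks F M u w ->
  lower M \proper lower (resolve M [set u; w]).
Proof.
move=> sF mM uU nu bl; case/and3P: (bl) => /(subsetP sF) uwE _ /welcomesP wu.
have wW : w \in W by rewrite -(crossing_edge uwE).
have wuE : [set w; u] \in edges G by rewrite setUC.
apply/properP; split.
  apply/subsetP => -[b a]; rewrite !inE /= => /and3P[bW baE /existsP[y]].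
  rewrite bW baE => /andP[byM by_] /=.
  have byE := matching_edges mM byM.
  have yU : y \in U by rewrite (@crossing_edge y b) // setUC.
  have neq_yu : y != u.
    by apply: contraNneq nu => <-; apply/existsP; exists b; rewrite setUC.
  have [eb|neq_bw] := eqVneq b w.
    subst b; apply/existsP; exists u; rewrite setUC setU11 /=.
    have puy := wu _ byM; case/orP: by_ => [/eqP->|pya];
      first by rewrite puy orbT.
    by rewrite (pref_trans wuE byE baE puy pya) orbT.
  apply/existsP; exists y; rewrite by_ andbT setUC mem_resolve //.
  by rewrite neq_yu neq_bw setUC byM orbT.
exists (w, u); rewrite !inE /= wW wuE /=.
  by apply/existsP; exists u; rewrite setUC setU11 eqxx.
apply/existsP => -[y /andP[wyM]]; have pwu := wu _ wyM.
have wyE := matching_edges mM wyM.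
case/orP => [/eqP ey|pyu].
  by subst y; rewrite (negPf (pref_irr wyE)) in pwu.
by have := pref_trans wyE wuE wyE pyu pwu; rewrite (negPf (pref_irr wyE)).
Qed.

Definition settled F M : Prop :=
  forall u w, u \in U -> is_matched M u -> ~~ blocks F M u w.

Lemma best_response F M u w : F \subset edges G -> blocks F M u w ->
  exists2 x, blocks F M u x & forall y, blocks F M u y -> ~~ pref u y x.
Proof.
move=> sF; have bE x : blocks F M u x -> [set u; x] \in edges G.
  by case/and3P => /(subsetP sF).
(* By transitivity of [pref], a blocking partner with the fewest strictly better neighbours is a
   most preferred one. *)
pose better x := [set y | ([set u; y] \in edges G) && pref u y x].
move=> bl; case: (@arg_minnP _ w (blocks F M u) (fun x => #|better x|) bl).
move=> x blx minx; exists x => // y bly; apply/negP => pyx.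
have := minx _ bly; rewrite leqNgt => /negP; apply; apply: proper_card.
apply/properP; split.
  apply/subsetP => z; rewrite !inE => /andP[zE pzy]; rewrite zE.
  exact: pref_trans zE (bE _ bly) (bE _ blx) pzy pyx.
by exists y; rewrite !inE (bE _ bly) //= (pref_irr (bE _ bly)).
Qed.

(** Partners on the side of [W] only improve, so a pair that blocks now with a matched player of [U]
    already blocked [M]. Settledness excludes this for players matched before, the choice of [w]
    excludes it for [u]. *)
Lemma settled_resolve F M u w : F \subset edges G -> matching M -> u \in U ->
  ~~ is_matched M u -> blocks F M u w ->
  (forall y, blocks F M u y -> ~~ pref u y w) ->
  settled F M -> settled F (resolve M [set u; w]).
Proof.
move=> sF mM uU nu bl best setM a b aU.
case/and3P: (bl) => uwF _ /welcomesP wu; have uwE := subsetP sF _ uwF.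
have wW : w \in W by rewrite -(crossing_edge uwE).
have wuE : [set w; u] \in edges G by rewrite setUC.
have mR := resolve_matching mM uwE.
move=> /existsP[y ay]; apply/negP => /and3P[abF /welcomesP ab /welcomesP ba].
have abE := subsetP sF _ abF; have ayE := matching_edges mR ay.
have [bW yW] : b \in W /\ y \in W.
  by rewrite -(crossing_edge abE) -(crossing_edge ayE).
(* Only w has changed partner on the W side, and for the better. *)
have ba' z : [set b; z] \in M -> pref b a z.
  move=> bzM; have bzE := matching_edges mM bzM.
  have zU : z \in U by rewrite (@crossing_edge z b) // setUC.
  have neq_zu : z != u.
    by apply: contraNneq nu => <-; apply/existsP; exists b; rewrite setUC.
  have [eb|neq_bw] := eqVneq b w; last first.
    by apply: ba; rewrite setUC mem_resolve // neq_zu neq_bw setUC bzM orbT.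
  subst b; have wa : [set w; a] \in edges G by rewrite setUC.
  apply: pref_trans wa wuE bzE (ba u _) (wu _ bzM).
  by rewrite setUC setU11.
have pby : pref a b y := ab _ ay.
move: ay; rewrite mem_resolve // =>
  /orP[/andP[/eqP ea /eqP ey]|/and3P[ayM _ _]].
  subst a y; have : blocks F M u b.
    apply/and3P; split=> //; apply/welcomesP => // x uxM.
    by case/negP: nu; apply/existsP; exists x.
  by move/best/negP.
have am : is_matched M a by apply/existsP; exists y.
have /negP := setM a b aU am; apply; apply/and3P; split=> //;
  apply/welcomesP => //.
by move=> x axM; rewrite (matching_inj mM axM ayM).
Qed.

(* First only matched players of U move, until none of them blocks; then
   unmatched players of U move to their best blocking partner, so that no
   matched player of U ever blocks again. *)
Lemma connect_stable F M : F \subset edges G -> matching M ->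
  exists M', [/\ connect (improves F) M M', matching M' &
    forall u w, ~~ blocks F M' u w].
Proof.
move=> sF mM.
have [M1 [MM1 mM1 setM1]] : exists M1,
    [/\ connect (improves F) M M1, matching M1 & settled F M1].
  apply: (@connect_descent _ (improves F) (fun M => #|upper M|)
    (@matching G) (settled F)) => // {mM}M mM.
  case: (boolP [exists u, exists w, [&& u \in U, is_matched M u &
    blocks F M u w]]).
    move=> /existsP[u /existsP[w /and3P[uU um bl]]]; right.
    exists (resolve M [set u; w]); split; first exact: improves_resolve.
      by apply: resolve_matching => //; case/and3P: bl => /(subsetP sF).
    exact/proper_card/upper_decr/bl.
  move=> nex; left=> u w uU um; apply: contra nex => bl.
  by apply/existsP; exists u; apply/existsP; exists w; apply/and3P.
have [M2 [M12 [mM2 _] stM2]] : exists M2, [/\ connect (improves F) M1 M2,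
    matching M2 /\ settled F M2 &
    forall u w, u \in U -> ~~ blocks F M2 u w].
  (* The descent needs a decreasing measure while [lower] grows, hence the complement. *)
  apply: (@connect_descent _ (improves F) (fun M => #|~: lower M|)
    (fun M => matching M /\ settled F M)
    (fun M => forall u w, u \in U -> ~~ blocks F M u w)) =>
      // {mM M1 MM1 mM1 setM1}M [mM setM].
  case: (boolP [exists u, exists w, (u \in U) && blocks F M u w]).
    move=> /existsP[u /existsP[w' /andP[uU bl']]]; right.
    have nu : ~~ is_matched M u by apply: contraL bl' => /setM; apply.
    have [w bl best] := best_response sF bl'.
    exists (resolve M [set u; w]); split; first exact: improves_resolve.
      split; last exact: settled_resolve.
      by apply: resolve_matching => //; case/and3P: bl => /(subsetP sF).
    by apply: proper_card; rewrite properC; apply: lower_incr bl.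
  move=> nex; left=> u w uU; apply: contra nex => bl.
  by apply/existsP; exists u; apply/existsP; exists w; rewrite uU.
exists M2; split=> //; first exact: connect_trans MM1 M12.
(* Every edge has an end in [U] and [blocks] is symmetric, so it is enough that no player of [U]
   blocks. *)
move=> u w; apply/negP => bl; have uwE : [set u; w] \in edges G.
  by case/and3P: bl => /(subsetP sF).
case: crossUW => dUW /(_ _ uwE)[u' [w' [u'U w'W eq_e]]].
have [uU|nuU] := boolP (u \in U); first by case/negP: (stM2 u w uU).
suff wU : w \in U by case/negP: (stM2 w u wU); rewrite blocks_sym.
have : u' \in [set u; w] by rewrite eq_e !inE eqxx.
by rewrite !inE => /orP[/eqP e|/eqP<- //]; rewrite -e u'U in nuU.
Qed.

End Bipartite.
End Matchings.

(** * Reachability of absorbing states *)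

From mathcomp Require Import reals.
Local Open Scope ring_scope.

Section States.
Variables (R : realType) (G : network_game).
Notation V := (player G).
Implicit Types (M : {set {set V}}) (H : history G) (m : memory G).
Implicit Types (x y z : state G).

Definition memory_ok H m : bool :=
  [forall v, if m v is Some w then w \in H v else H v == finset.set0].

Lemma memory_prob_ge0 H m : 0 <= memory_prob R H m.
Proof.
apply: prodr_ge0 => v _; case: (m v) => [w|]; last exact: ler0n.
by case: ifP; rewrite ?invr_ge0 ?ler0n.
Qed.

Lemma memory_prob_gt0 H m : (0 < memory_prob R H m) = memory_ok H m.
Proof.
rewrite lt0r memory_prob_ge0 andbT.
apply/prodf_neq0/forallP => ok v; last move=> _.
  have := ok v isT; case: (m v) => [w|]; first by case: ifP; rewrite ?eqxx.
  by case: (H v == _); rewrite ?eqxx.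
have := ok v; case: (m v) => [w wH|-> //]; last by rewrite oner_eq0.
rewrite wH invr_eq0 pnatr_eq0 cards_eq0.
by apply: contraTneq wH => ->; rewrite inE.
Qed.

(** The players draw independently, so the memory of [u] can be prescribed while the others draw
    arbitrarily. *)
Lemma memory_ok_remember H u w : w \in H u ->
  exists2 m, memory_ok H m & m u = Some w.
Proof.
move=> wH; exists [ffun v => if v == u then Some w else [pick z in H v]].
  apply/forallP => v; rewrite ffunE; case: eqVneq => [->//|_].
  case: pickP => // H0; apply/eqP/setP => z; rewrite inE; exact: H0.
by rewrite ffunE eqxx.
Qed.

Lemma memory_ok_ex H : exists m, memory_ok H m.
Proof.
exists [ffun v => [pick z in H v]]; apply/forallP => v; rewrite ffunE.
by case: pickP => // H0; apply/eqP/setP => z; rewrite inE; exact: H0.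
Qed.

Definition may_step M m M' : bool :=
  if local_blocking_pairs M m == finset.set0 then M' == M
  else [exists e in local_blocking_pairs M m, M' == resolve M e].

Lemma step_prob_ge0 M m M' : 0 <= step_prob R M m M'.
Proof.
rewrite /step_prob; case: ifP => // _; apply: sumr_ge0 => e _.
by rewrite mulr_ge0 ?invr_ge0 ?ler0n.
Qed.

Lemma step_prob_gt0 M m M' : (0 < step_prob R M m M') = may_step M m M'.
Proof.
rewrite /step_prob /may_step; case: ifP => [_|nB0]; first by case: eqP;
  rewrite ?ltr01 ?ltxx.
have term_ge0 e : e \in local_blocking_pairs M m ->
    0 <= #|local_blocking_pairs M m|%:R^-1 * (M' == resolve M e)%:R :> R.
  by move=> _; rewrite mulr_ge0 ?invr_ge0 ?ler0n.
rewrite lt0r sumr_ge0 // andbT psumr_neq0 //.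
apply/hasP/exists_inP => [[e _ /andP[eB gt0]]|[e eB eqM']]; exists e => //.
  by move: gt0; case: (M' == _); rewrite ?mulr0 ?ltxx.
by rewrite eB eqM' mulr1 invr_gt0 ltr0n card_gt0 nB0.
Qed.

Definition can_move : rel (state G) := fun x y => 0 < transition_prob R x y.

Lemma transition_prob_ge0 x y : 0 <= transition_prob R x y.
Proof. by rewrite !mulr_ge0 ?step_prob_ge0 ?memory_prob_ge0. Qed.

Lemma can_moveE x y : can_move x y =
  [&& may_step (matching_of x) (memory_of x) (matching_of y),
      history_of y == record_partners (matching_of x) (history_of x)
    & memory_ok (history_of y) (memory_of y)].
Proof.
rewrite /can_move lt0r transition_prob_ge0 andbT !mulf_eq0 !negb_or.
rewrite -step_prob_gt0 -memory_prob_gt0 !lt0r step_prob_ge0 memory_prob_ge0.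
by rewrite !andbT -andbA; case: (_ == record_partners _ _);
  rewrite ?oner_eq0 ?eqxx.
Qed.

(** The next matching and history do not depend on the new memory, so one [M] serves for all
    memories. *)
Lemma can_move_ex x : exists M, forall m,
  memory_ok (record_partners (matching_of x) (history_of x)) m ->
  can_move x (M, record_partners (matching_of x) (history_of x), m).
Proof.
have [M may] : exists M, may_step (matching_of x) (memory_of x) M.
  rewrite /may_step; have [->|[e eB]] :=
    set_0Vmem (local_blocking_pairs (matching_of x) (memory_of x)).
    by exists (matching_of x); rewrite !eqxx.
  exists (resolve (matching_of x) e); case: ifP => [/eqP B0|_].
    by rewrite B0 inE in eB.
  by apply/exists_inP; exists e.
by exists M => m ok; rewrite can_moveE may eqxx ok.
Qed.

Definition valid x : Prop := [/\ matching (matching_of x),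
  forall v w, w \in history_of x v ->
    v \in history_of x w /\ [set v; w] \in edges G
  & memory_ok (history_of x) (memory_of x)].

Lemma valid_move x y : valid x -> can_move x y -> valid y.
Proof.
case=> mM symH _; rewrite can_moveE => /and3P[may /eqP eqH ok]; split=> //.
  move: may; rewrite /may_step; case: ifP => [_ /eqP->//|_].
  case/exists_inP => e eB /eqP->; apply: resolve_matching => //.
  by move: eB; rewrite inE => /andP[].
move=> v w; rewrite eqH !ffunE !inE => /orP[/symH[-> ->]//|vw].
by split; [rewrite setUC vw orbT | exact: matching_edges vw].
Qed.

(** Stability depends on the memory drawn, so it is required along the whole future; this also makes
    the property closed under moves. *)
Definition absorbed x : bool := [forall y, connect can_move x y ==>
  (matching_of y == matching_of x) &&
  locally_stable_matching (matching_of y) (memory_of y)].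

Lemma absorbed_move x y : absorbed x -> can_move x y -> absorbed y.
Proof.
move=> /forallP abs xy; have cxy := connect1 xy; apply/forallP => z;
  apply/implyP => yz.
have := abs z; rewrite (connect_trans cxy yz) /= => /andP[/eqP-> ->].
by have := abs y; rewrite cxy /= eq_sym => /andP[->].
Qed.

Definition weight x : nat := (\sum_v #|history_of x v|)%N.

Lemma history_mono x y : connect can_move x y ->
  forall v, history_of x v \subset history_of y v.
Proof.
apply: (connect_invariant (P := fun y =>
  forall v, history_of x v \subset history_of y v)) => //.
move=> z t sub; rewrite can_moveE => /and3P[_ /eqP-> _] v.
by rewrite ffunE (subset_trans (sub v)) // subsetUl.
Qed.

(** * From a valid state to an absorbed one *)

Section Reach.
Variables U W : {set V}.
Hypothesis crossUW : crossing U W.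

Lemma connect_absorbed x :
  valid x -> exists2 y, connect can_move x y & absorbed y.
Proof.
(* y maximises the size of the history, which no longer grows after it. *)
move=> vx; case: (@arg_maxnP _ x (connect can_move x) weight (connect0 _ _)) =>
  y xy maxy.
have vy : valid y := connect_invariant valid_move vx xy.
pose H := history_of y.
(* By maximality the weights agree; as histories only grow, equal sums force equality at every
   player. *)
have histE z : connect can_move y z -> history_of z = H.
  move=> yz; have sub := history_mono yz.
  have /eqP eqw : weight y == weight z.
    have le_zy : (weight z <= weight y)%N := maxy z (connect_trans xy yz).
    rewrite eqn_leq le_zy andbT.
    by apply: leq_sum => v _; apply/subset_leq_card/sub.
  apply/ffunP => v; apply/esym/eqP; rewrite eqEcard sub /=.
  move: eqw; rewrite /weight (bigD1 v) // [X in _ = X -> _](bigD1 v) //= => eqw.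
  rewrite -(leq_add2r (\sum_(i | i != v) #|history_of y i|)) eqw leq_add2l.
  by apply: leq_sum => i _; apply/subset_leq_card/sub.
(* A move out of [z] records the partners held in [z], and the resulting history is still [H]. *)
have recE z : connect can_move y z -> record_partners (matching_of z) H = H.
  move=> yz; have [M mv] := can_move_ex z; have [m ok] := memory_ok_ex
    (record_partners (matching_of z) (history_of z)).
  have := histE _ (connect_trans yz (connect1 (mv m ok))).
  by rewrite -(histE z yz).
have [_ symH _] := vy.
have memH z u v : connect can_move y z ->
    [set u; v] \in matching_of z -> v \in H u.
  by move=> yz uv; rewrite -(recE z yz) ffunE !inE uv orbT.
pose F := [set e | [exists u, exists v, (e == [set u; v]) && (v \in H u)]].
have inF u v : v \in H u -> [set u; v] \in F.
  by move=> vH; rewrite inE; apply/existsP; exists u; apply/existsP; exists v;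
    rewrite eqxx.
have sF : F \subset edges G.
  apply/subsetP => e; rewrite inE =>
    /existsP[u /existsP[v /andP[/eqP-> /symH[]//]]].
have FH u w : [set u; w] \in F -> w \in H u.
  move=> uwF; have /edge_neq := subsetP sF _ uwF; move: uwF.
  rewrite inE => /existsP[a /existsP[b /andP[/eqP eq_e bH]]].
  have [aH _] := symH _ _ bH.
  have : u \in [set a; b] by rewrite -eq_e !inE eqxx.
  have : w \in [set a; b] by rewrite -eq_e !inE eqxx orbT.
  by rewrite !inE => /orP[]/eqP-> /orP[]/eqP->; rewrite ?eqxx.
(* Asking for every possible memory leaves it free to be chosen once the next pair to resolve is
   known. *)
pose attained M := forall m, memory_ok H m -> connect can_move y (M, H, m).
have [M1 att1] : exists M, attained M.
  have [M mv] := can_move_ex y; exists M => m ok; apply: connect1.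
  by have := mv m; rewrite -/H recE ?connect0 //; apply.
have resolve_move M m e m' : attained M -> memory_ok H m -> memory_ok H m' ->
    e \in local_blocking_pairs M m -> connect can_move y (resolve M e, H, m').
  move=> att ok ok' eB; have yM := att m ok.
  apply: (connect_trans yM); apply: connect1.
  rewrite can_moveE /= (recE _ yM) eqxx ok' !andbT /may_step.
  case: ifP => [/eqP B0|_]; first by rewrite B0 inE in eB.
  by apply/exists_inP; exists e.
(* Letting [u] remember [w] makes the pair accessible. *)
have attS M M' : attained M -> improves F M M' -> attained M'.
  move=> att /existsP[u /existsP[w /andP[/and3P[uwF uw wu] /eqP->]]] m' ok'.
  have uwH := FH _ _ uwF; have [m ok mu] := memory_ok_remember uwH.
  apply: (resolve_move M m) => //; rewrite inE (subsetP sF _ uwF) /=.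
  apply/existsP; exists u; apply/existsP; exists w.
  by rewrite eqxx uw wu /accessible mu eqxx orbT.
have vM M : attained M -> matching M.
  move=> att; have [m ok] := memory_ok_ex H.
  by case: (connect_invariant valid_move vy (att m ok)).
have [M [M1M _ stM]] := connect_stable crossUW sF (vM _ att1).
have attM : attained M by apply: connect_invariant attS att1 M1M.
(* Once resolved, a local blocking pair is matched and hence lies in [H]. It is then a pair of [F]
   that blocks [M], against stability. *)
have noB m : memory_ok H m -> local_blocking_pairs M m = finset.set0.
  move=> ok; apply/setP => e; rewrite [RHS]inE; apply/negP => eB.
  have yRe := resolve_move M m e m attM ok ok eB.
  move: (eB); rewrite inE.
  case/andP => _ /existsP[u /existsP[w /and4P[/eqP eq_e _ uw wu]]].
  have uwH : w \in H u by apply: memH yRe _; rewrite /= eq_e setU11.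
  by have /negP := stM u w; apply; rewrite /blocks inF // uw.
have [m0 ok0] := memory_ok_ex H; have yM0 := attM m0 ok0.
exists (M, H, m0); first exact: connect_trans xy yM0.
apply/forallP => z; apply/implyP => Mz.
(* No memory drawn from [H] offers a blocking pair, so from here on only the memory changes. *)
suff [-> _ okz] : [/\ matching_of z = M, history_of z = H &
  memory_ok H (memory_of z)].
  by rewrite eqxx /= /locally_stable_matching vM // noB // eqxx.
apply: (connect_invariant (P := fun z => [/\ matching_of z = M,
  history_of z = H & memory_ok H (memory_of z)])) Mz => //.
move=> {}z t [zM zH okz]; rewrite can_moveE /may_step zM noB // eqxx.
case/and3P => /eqP-> /eqP-> ok; have recM := recE _ yM0; rewrite /= in recM.
by move: ok; rewrite zH recM.
Qed.

End Reach.
End States.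

(** * Absorption of finite Markov chains *)

From mathcomp Require Import all_classical all_reals all_analysis.
Import numFieldNormedType.Exports.
Local Open Scope classical_set_scope.
Local Open Scope ring_scope.

Section HittingProbability.
Variables (R : realType) (S : finType) (p : S -> S -> R) (C A : pred S).
Hypothesis p_ge0 : forall x y, 0 <= p x y.
Hypothesis p_sum1 : forall x, C x -> \sum_y p x y = 1.
Hypothesis C_closed : forall x y, C x -> 0 < p x y -> C y.
Hypothesis A_closed : forall x y, A x -> 0 < p x y -> A y.
Hypothesis A_accessible : forall x, C x ->
  exists2 y, connect (fun z t => 0 < p z t) x y & A y.

(** Backward recursion: where the rows of [p] are stochastic, this is the probability that the chain
    started at [x] is outside [A] at time [t], that is, as [A] is closed, that it has not entered
    [A] by then. *)
Fixpoint survival t x : R :=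
  if t is t'.+1 then \sum_y p x y * survival t' y else (~~ A x)%:R.

Lemma survival_ge0 t x : 0 <= survival t x.
Proof.
elim: t x => [|t IHt] x /=; first exact: ler0n.
by apply: sumr_ge0 => y _; rewrite mulr_ge0.
Qed.

Lemma survival_A t x : A x -> survival t x = 0.
Proof.
elim: t x => [|t IHt] x Ax /=; first by rewrite Ax.
apply: big1 => y _; have := p_ge0 x y; rewrite le_eqVlt.
case/predU1P => [<-|pxy]; first by rewrite mul0r.
by rewrite IHt ?mulr0 //; exact: A_closed pxy.
Qed.

(** The first value is at most the row sum 1, and is 0 from [A]; the recursion preserves the
    inequality. *)
Lemma survival_decr t x : C x -> survival t.+1 x <= survival t x.
Proof.
elim: t x => [|t IHt] x Cx.
  have [Ax|nAx] := boolP (A x); first by rewrite survival_A // survival_ge0.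
  suff : survival 1 x <= \sum_y p x y by rewrite p_sum1 //= nAx.
  apply: ler_sum => y _.
  by rewrite ler_piMr // lern1 leq_b1.
rewrite /= ler_sum // => y _; have := p_ge0 x y; rewrite le_eqVlt.
case/predU1P => [<-|pxy]; first by rewrite !mul0r.
by rewrite ler_pM2l // IHt //; exact: C_closed pxy.
Qed.

Lemma is_cvg_survival x : C x -> cvgn (survival^~ x).
Proof.
move=> Cx; apply: nonincreasing_is_cvgn.
  by apply/nonincreasing_seqP => t; exact: survival_decr.
by exists 0 => _ [t _ <-]; exact: survival_ge0.
Qed.

(* The limit is harmonic, so its maximum propagates along the transitions up to
   A, where it vanishes. *)
Lemma survival_cvg0 x : C x -> survival^~ x @ \oo --> (0 : R).
Proof.
move=> Cx; pose g y := limn (survival^~ y).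
have cvg_g y : C y -> survival^~ y @ \oo --> g y by exact: is_cvg_survival.
have g_ge0 y : C y -> 0 <= g y.
  move=> Cy; apply: limr_ge; first exact: is_cvg_survival.
  by apply: nearW => t; exact: survival_ge0.
(* Convergence to [g] is known only on [C]; since [p y z] vanishes outside [C], the other terms are
   dropped before passing to the limit. *)
have restrict h y : C y -> \sum_z p y z * h z = \sum_(z | C z) p y z * h z.
  move=> Cy; rewrite [RHS]big_mkcond; apply: eq_bigr => z _;
    case: ifPn => // nCz.
  have := p_ge0 y z; rewrite le_eqVlt =>
    /predU1P[<-|/(C_closed Cy)/(negP nCz)//].
  by rewrite mul0r.
have harmonic y : C y -> g y = \sum_z p y z * g z.
  move=> Cy; apply: (@cvg_lim R) => //.
  rewrite -(cvg_shiftS (survival^~ y)) /=.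
  rewrite restrict //; under eq_cvg do rewrite restrict //.
  apply: cvg_big => [|z Cz]; first exact: add_continuous.
  by apply: cvgMr; exact: cvg_g.
case: (@arg_maxP _ _ _ x C g Cx) => m Cm maxm.
suff gm0 : g m = 0.
  have -> : 0 = g x by apply/eqP; rewrite eq_le g_ge0 //= -gm0; exact: maxm.
  exact: cvg_g.
have [a ma Aa] := A_accessible Cm.
have [Ca <-] : C a /\ g a = g m.
  apply: (connect_invariant (P := fun z => C z /\ g z = g m)) ma => //.
  move=> y z [Cy gy] pyz; have Cz := C_closed Cy pyz; split=> //.
  (* The average of the gaps [g m - g t] over the successors of [y] is 0 and none of them is
     negative there, so each successor attains the maximum too. *)
  have : \sum_t p y t * (g m - g t) = 0.
    under eq_bigr do rewrite mulrBr.
    by rewrite sumrB -mulr_suml p_sum1 // mul1r -harmonic // gy subrr.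
  have t_ge0 t : true -> 0 <= p y t * (g m - g t).
    move=> _; have := p_ge0 y t; rewrite le_eqVlt => /predU1P[<-|pyt].
      by rewrite mul0r.
    by rewrite pmulr_rge0 // subr_ge0; apply: maxm; exact: C_closed pyt.
  move/eqP; rewrite psumr_eq0 // => /allP/(_ z (mem_index_enum _)) /=.
  by rewrite mulf_eq0 gt_eqF //= subr_eq0 => /eqP.
by apply: (@cvg_lim R) => //; rewrite (_ : survival^~ a = cst 0);
  [exact: cvg_cst | apply/funext => t; rewrite survival_A].
Qed.

End HittingProbability.

(** * Almost sure absorption of a chain given by its path law *)

Section MarkovChain.
Variables (R : realType) (S : finType) (init : S -> R) (p : S -> S -> R).
Variables (d : measure_display) (Omega : measurableType d).
Variables (P : probability Omega R) (X : nat -> Omega -> S).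
Hypothesis mX : forall t x, measurable [set w | X t w = x].
Hypothesis path_law : forall t (x : nat -> S),
  P [set w | forall s, (s <= t)%N -> X s w = x s] =
  (init (x 0%N) * \prod_(0 <= s < t) p (x s) (x s.+1))%:E.
Hypothesis p_ge0 : forall x y, 0 <= p x y.

Lemma measurable_state t (Q : set S) : measurable [set w | Q (X t w)].
Proof.
rewrite (_ : [set w | _] = \bigcup_(x in Q) [set w | X t w = x]).
  by apply: fin_bigcup_measurable => // x _; exact: mX.
by apply/seteqP; split => w /= => [Qw|[x Qx -> //]]; exists (X t w).
Qed.

Definition prob (B : set Omega) : R := fine (P B).

Lemma probE B : measurable B -> P B = (prob B)%:E.
Proof. by move=> mB; rewrite /prob fineK // fin_num_measure. Qed.

Lemma prob_split t B : measurable B ->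
  prob B = \sum_x prob (B `&` [set w | X t w = x]).
Proof.
move=> mB; have mBx x : measurable (B `&` [set w | X t w = x]).
  by apply: measurableI.
suff split_seq (s : seq S) : uniq s ->
    prob (B `&` [set w | X t w \in s]) =
      \sum_(x <- s) prob (B `&` [set w | X t w = x]).
  rewrite -split_seq ?index_enum_uniq //; congr prob.
  by apply/seteqP; split => w /= => [Bw|[]//]; split=> //;
    exact: mem_index_enum.
elim: s => [_|x s IHs /= /andP[xs us]].
  rewrite big_nil (_ : _ `&` _ = set0) /prob ?measure0 //.
  by rewrite -subset0 => w [_ /=]; rewrite in_nil.
rewrite big_cons -IHs //; apply: EFin_inj; rewrite EFinD -!probE //.
- rewrite -measureU //.
  + congr (P _); apply/seteqP; split => w /=.
      by rewrite inE => -[Bw /predU1P[]]; [left|right].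
    by rewrite inE => -[[Bw ->]|[Bw ->]]; rewrite ?eqxx ?orbT.
  + by apply: measurableI => //; exact: (measurable_state t [set x | x \in s]).
  + by rewrite -subset0 => w [[_ /= ->] [_ /=]]; rewrite (negPf xs).
- by apply: measurableI => //; exact: (measurable_state t [set x | x \in s]).
- by apply: measurableI => //;
  exact: (measurable_state t [set y | y \in x :: s]).
Qed.

Definition law t x : R := prob [set w | X t w = x].

Lemma law_ge0 t x : 0 <= law t x.
Proof. by rewrite fine_ge0. Qed.

(** [path_law] only gives windows that start at time 0; later windows are needed for the Markov
    property. *)
Definition trajectory (x : nat -> S) j t : set Omega :=
  [set w | forall s, (j <= s <= t)%N -> X s w = x s].

Lemma measurable_trajectory x j t : measurable (trajectory x j t).
Proof.
rewrite (_ : trajectory x j t =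
  \bigcap_(s in [set s | (j <= s <= t)%N]) [set w | X s w = x s]) //.
by apply: bigcap_measurableType => s _; exact: mX.
Qed.

(** Induction on [j]: a window from [j.+1] splits, according to the state at time [j], into windows
    from [j], and all of them have the same last transition. *)
Lemma trajectory_step x j t : (j <= t)%N ->
  prob (trajectory x j t.+1) = prob (trajectory x j t) * p (x t) (x t.+1).
Proof.
have traj0 n y : prob (trajectory y 0 n) =
    init (y 0%N) * \prod_(0 <= s < n) p (y s) (y s.+1).
  by rewrite /prob path_law.
elim: j x => [|j IHj] x le_jt; first by rewrite !traj0 big_nat_recr //= mulrA.
rewrite (prob_split j) ?(prob_split j (B := trajectory x j.+1 t)) //;
  try exact: measurable_trajectory.
rewrite mulr_suml; apply: eq_bigr => y _.
pose x' s := if s == j then y else x s.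
have traj n : (j <= n)%N -> trajectory x j.+1 n `&` [set w | X j w = y] =
  trajectory x' j n.
  move=> le_jn; apply/seteqP; split => w /=.
    case=> xw yw s /andP[js sn]; rewrite /x'; case: eqVneq => [->//|neq_sj].
    by apply: xw; rewrite sn ltn_neqAle eq_sym neq_sj js.
  move=> x'w; split=> [s /andP[js sn]|].
    by have := x'w s; rewrite /x' gtn_eqF // (ltnW js) sn; apply.
  by have := x'w j; rewrite /x' eqxx leqnn le_jn; apply.
rewrite !traj ?IHj ?(ltnW le_jt) // 1?leqW ?(ltnW le_jt) //.
by rewrite /x' !gtn_eqF // leqW.
Qed.

Lemma joint_law t x y :
  prob ([set w | X t w = x] `&` [set w | X t.+1 w = y]) = law t x * p x y.
Proof.
pose x' s := if s == t then x else y.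
have x't : x' t = x by rewrite /x' eqxx.
have x'S : x' t.+1 = y by rewrite /x' gtn_eqF.
have -> : [set w | X t w = x] `&` [set w | X t.+1 w = y] = trajectory x' t t.+1.
  apply/seteqP; split => w /=.
    case=> xw yw s /andP[]; rewrite leq_eqVlt => /predU1P[<- _|ts st];
      first by rewrite x't.
    by rewrite (_ : s = t.+1) ?x'S //; apply/eqP; rewrite eqn_leq st.
  by move=> x'w; split; rewrite -?x't -?x'S; apply: x'w; rewrite ?leqnn ?leqnSn.
have -> : law t x = prob (trajectory x' t t).
  congr prob; apply/seteqP; split => w /= => [xw s|].
    by rewrite -eqn_leq => /eqP <-; rewrite x't.
  by rewrite -x't; apply; rewrite leqnn.
by rewrite trajectory_step // x't x'S.
Qed.

Lemma law0 x : law 0 x = init x.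
Proof.
have := path_law 0 (fun=> x); rewrite big_nil mulr1 => law_x.
apply: EFin_inj; rewrite -law_x -probE //; congr (P _); apply/seteqP;
  split => w /=.
  by move=> xw s; rewrite leqn0 => /eqP->.
by apply.
Qed.

Lemma lawS t y : law t.+1 y = \sum_x law t x * p x y.
Proof.
rewrite {1}/law (prob_split t) //; apply: eq_bigr => x _.
by rewrite setIC joint_law.
Qed.

(** Summing the joint law over [y] gives back [law t x], which cancels. The rows are thus shown
    stochastic from the path law itself. *)
Lemma law_sum1 t x : 0 < law t x -> \sum_y p x y = 1.
Proof.
move=> lx; apply: (mulfI (lt0r_neq0 lx)); rewrite mulr1 mulr_sumr {2}/law.
by rewrite (prob_split t.+1) //; apply: eq_bigr => y _; rewrite joint_law.
Qed.

Definition reached x : bool := `[< exists t, 0 < law t x >].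

Lemma reached_invariant (Q : S -> Prop) :
  (forall x, 0 < init x -> Q x) -> (forall x y, Q x -> 0 < p x y -> Q y) ->
  forall x, reached x -> Q x.
Proof.
move=> Q0 QS x /asboolP[t]; elim: t x => [|t IHt] x; first by rewrite law0;
  exact: Q0.
rewrite lawS lt0r psumr_neq0 => [/andP[/hasP[y _ /= gt0] _]|y _];
  last by rewrite mulr_ge0 ?law_ge0.
have ly : 0 < law t y.
  by rewrite lt0r law_ge0 andbT; apply: contraTneq gt0 => ->;
    rewrite mul0r ltxx.
by apply: QS (IHt y ly) _; rewrite pmulr_rgt0 in gt0.
Qed.

Variable A : pred S.
Hypothesis A_closed : forall x y, A x -> 0 < p x y -> A y.
Hypothesis A_accessible : forall x, reached x ->
  exists2 y, connect (fun z t => 0 < p z t) x y & A y.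

(** Each use of [lawS] moves one step from the forward law to the backward recursion. *)
Lemma law_survival s t :
  \sum_x law (s + t) x * (~~ A x)%:R = \sum_x law s x * survival p A t x.
Proof.
elim: t s => [|t IHt] s; first by rewrite addn0.
rewrite addnS -addSn IHt /=.
under eq_bigr do rewrite lawS mulr_suml.
rewrite exchange_big; apply: eq_bigr => x _; rewrite mulr_sumr.
by apply: eq_bigr => y _; rewrite mulrA.
Qed.

Lemma prob_not_absorbed_cvg0 :
  (fun t => prob [set w | ~~ A (X t w)]) @ \oo --> (0 : R).
Proof.
(* States that are not reached carry no initial mass; without them only rows with sum 1 remain. *)
have surv t : prob [set w | ~~ A (X t w)] =
  \sum_(x | reached x) law 0 x * survival p A t x.
  rewrite [RHS]big_mkcond [RHS](_ : _ = \sum_x law 0 x * survival p A t x).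
    rewrite -law_survival add0n (prob_split t);
      last exact: (measurable_state t [set x | ~~ A x]).
    apply: eq_bigr => x _; case: (boolP (A x)) => Ax /=; rewrite ?mulr1 ?mulr0.
      rewrite (_ : _ `&` _ = set0) /prob ?measure0 //.
      by rewrite -subset0 => w [/= nA Xx]; rewrite Xx Ax in nA.
    by congr prob; apply/seteqP; split => w /= => [[]|->].
  apply: eq_bigr => x _; case: ifPn => // /asboolPn nr.
  have := law_ge0 0 x; rewrite le_eqVlt => /predU1P[<-|l0];
    first by rewrite mul0r.
  by case: nr; exists 0%N.
have sum0 : \sum_(x | reached x) 0 = 0 :> R by rewrite big1.
rewrite (funext surv) -[X in _ --> X]sum0.
apply: cvg_big => [|x rx]; first exact: add_continuous.
rewrite -[X in _ --> X](mulr0 (law 0 x)); apply: cvgMr.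
apply: (survival_cvg0 (C := reached)) => //.
- by move=> y /asboolP[t]; exact: law_sum1.
- move=> y z /asboolP[t ly] pyz; apply/asboolP; exists t.+1.
  rewrite lawS (bigD1 y) //=; apply: ltr_wpDr; last exact: mulr_gt0.
  by apply: sumr_ge0 => u _; rewrite mulr_ge0 ?law_ge0.
Qed.

Lemma negligible_impossible :
  P.-negligible [set w | exists t, p (X t w) (X t.+1 w) = 0].
Proof.
pose E t (z : S * S) := [set w | X t w = z.1] `&` [set w | X t.+1 w = z.2].
(* A countable union of null events, the pairs of states being coded by [pickle]. *)
apply: (@negligibleS _ _ _ _ (\bigcup_t \bigcup_n
  if unpickle n is Some z then if p z.1 z.2 == 0 then E t z else set0 else
    set0)).
  move=> w [t /eqP pw]; exists t => //; exists (pickle (X t w, X t.+1 w)) => //.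
  by rewrite pickleK /= pw.
apply: negligible_bigcup => t; apply: negligible_bigcup => n.
case: (unpickle n) => [z|]; last exact: negligible_set0.
case: ifP => [/eqP pz|_]; last exact: negligible_set0.
have mE : measurable (E t z) by exact: measurableI.
have PE0 : P (E t z) = 0 by rewrite probE // joint_law pz mulr0.
exact/negligibleP.
Qed.

(** The event lies in each event of being outside [A] at time [t], and their probabilities tend to
    0. *)
Lemma negligible_never_absorbed :
  P.-negligible [set w | forall t, ~~ A (X t w)].
Proof.
have mN t : measurable [set w | ~~ A (X t w)].
  exact: (measurable_state t [set x | ~~ A x]).
have mI : measurable [set w | forall t, ~~ A (X t w)].
  rewrite (_ : [set w | _] = \bigcap_t [set w | ~~ A (X t w)]).
    by apply: bigcapT_measurable.
  by apply/seteqP; split => w nA t => [_|]; exact: nA.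
suff PI0 : P [set w | forall t, ~~ A (X t w)] = 0 by exact/negligibleP.
rewrite probE //; congr EFin; apply/eqP; rewrite eq_le fine_ge0 // andbT.
apply: (cvgr_to_ge prob_not_absorbed_cvg0); apply: nearW => t.
rewrite -lee_fin -!probE //; apply: le_measure; rewrite ?inE //.
by move=> w; exact.
Qed.

(** Off the two null sets above, the path enters [A] and only makes transitions of positive
    probability. *)
Lemma negligible_not_absorbed : P.-negligible [set w | ~ exists t, A (X t w) /\
  forall s, (t <= s)%N -> connect (fun x y => 0 < p x y) (X t w) (X s w)].
Proof.
apply: negligibleS (negligibleU negligible_impossible
  negligible_never_absorbed).
move=> w /= nabs; apply: contrapT =>
  /not_orP[possible /existsNP[t /negP/negPn At]].
apply: nabs; exists t; split=> // s; elim: s => [|s IHs].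
  by rewrite leqn0 => /eqP->.
rewrite leq_eqVlt => /predU1P[->//|ts];
  apply: connect_trans (IHs ts) (connect1 _).
by rewrite lt0r p_ge0 andbT; apply/eqP => p0; apply: possible; exists s.
Qed.

End MarkovChain.

(** * Convergence of the random dynamics *)

Lemma valid_initial (R : realType) (G : network_game) 
    (M0 : {set {set player G}}) (x : state G) : matching M0 -> 0 < initial_prob R M0 x -> valid x.
Proof.
move=> mM0; rewrite /initial_prob; case: eqP => [eM|_];
  last by rewrite !mul0r ltxx.
case: eqP => [eH|_]; last by rewrite mulr0 mul0r ltxx.
rewrite !mul1r memory_prob_gt0 => ok; split; rewrite ?eM //.
by move=> v w; rewrite eH ffunE finset.in_set0.
Qed.

Theorem theorem14 (R : realType) (G : network_game) (hG : bipartite G)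
    (M0 : {set {set player G}}) (hM0 : matching M0)
    (d : measure_display) (Omega : measurableType d) (P : probability Omega R)
    (X : nat -> Omega -> state G) (hX : random_dynamics M0 P X) :
  P [set w | converges_to_locally_stable (fun t => X t w)]%classic = 1%:E.
Proof.
case: hG => U [W [_ dUW exUW]]; case: hX => mX path_law.
have crossUW : crossing U W by [].
set conv := [set w | _].
(* Measurability turns the negligible complement into an event of probability 0. *)
have m_conv : measurable conv.
  rewrite (_ : conv = \bigcup_M \bigcup_T \bigcap_(t in [set t | (T <= t)%N])
      [set w | matching_of (X t w) = M /\
               locally_stable_matching M (memory_of (X t w))]).
    apply: fin_bigcup_measurable => // M _; apply: bigcup_measurable => T _.
    apply: bigcap_measurableType => t _.
    exact: (measurable_state mX t [set x |
      matching_of x = M /\ locally_stable_matching M (memory_of x)]).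
  apply/seteqP; split => w /= [M].
    by case=> T st; exists M => //; exists T.
  by move=> _ [T _ st]; exists M, T.
have reached_absorbs x : reached P X x ->
    exists2 y, connect (fun z t => 0 < transition_prob R z t) x y
             & absorbed R y.
  move=> rx; apply: (connect_absorbed R crossUW).
  apply: (reached_invariant mX path_law (@transition_prob_ge0 R G) _ _ rx).
    by move=> z; exact: valid_initial.
  by move=> z t; exact: (@valid_move R).
have null : P (~` conv) = 0.
  apply/negligibleP; first exact: measurableC.
  apply: negligibleS (negligible_not_absorbed mX path_law
    (@transition_prob_ge0 R G) (@absorbed_move R G) reached_absorbs).
  move=> w; apply: contra_not => -[t [/forallP abs conn]].
  (* The limit is the matching held at a time when the state is absorbed. *)
  exists (matching_of (X t w)), t => s ts.
  by have := abs (X s w); rewrite (conn s ts) /= => /andP[/eqP <- ->].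
by rewrite -(setCK conv) probability_setC ?null ?sube0 //; exact: measurableC.
Qed.
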